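(* Let $G$ be a connected graph of order $n$ and minimum degree $\delta \geq 3$ that contains neither a $4$-cycle nor a $5$-cycle as a subgraph. Then \[ \operatorname{avec}(G) \leq \frac{9}{2} \Big\lceil \frac{n}{\delta^\circ} \Big\rceil + 8, \] where $\delta^\circ = 2\delta^2-5\delta+5$ if $\delta$ is even, and $\delta^\circ = 2\delta^2-5\delta+7$ if $\delta$ is odd.
   Context: All graphs are finite and simple. For a connected graph $G$, the eccentricity $e_G(v)$ of a vertex $v$ is $\max_{w\in V(G)} d_G(v,w)$, where $d_G$ is the shortest-path distance, and the average eccentricity is $\operatorname{avec}(G)=\frac{1}{n}\sum_{v\in V(G)} e_G(v)$ with $n=|V(G)|$. ''Containing a $k$-cycle as a subgraph'' means containing a cycle of length $k$, not necessarily induced. *)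

(* Defs.v *)
From mathcomp Require Import all_boot all_order all_algebra.
Set Implicit Arguments.
Unset Strict Implicit.
Unset Printing Implicit Defensive.
Import Order.TTheory GRing.Theory Num.Theory.

(* A finite simple graph is a symmetric irreflexive relation e on a finType T. *)

Definition gconnected (T : finType) (e : rel T) : Prop :=
  (0 < #|T|)%N /\ forall x y : T, connect e x y.

Definition degree (T : finType) (e : rel T) (v : T) : nat :=
  #|[set w | e v w]|.

(* The default #|T| is never attained by a degree of an irreflexive relation,
   so this is the true minimum as soon as T is nonempty. *)
Definition min_degree (T : finType) (e : rel T) : nat :=
  \big[minn/#|T|]_(v : T) degree e v.

(* The least k < #|T| such that some walk with k edges joins x to y. A shortest
   walk has fewer than #|T| edges; the value is #|T| when x and y are not
   connected. *)
Definition gdist (T : finType) (e : rel T) (x y : T) : nat :=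
  find (fun k => [exists p : k.-tuple T, path e x p && (last x p == y)])
       (iota 0 #|T|).

Definition ecc (T : finType) (e : rel T) (v : T) : nat :=
  \max_(w : T) gdist e v w.

Definition avec (T : finType) (e : rel T) : rat :=
  ((\sum_(v : T) (ecc e v)%:R) / #|T|%:R)%R.

(* Not necessarily induced; meaningful for k >= 3. *)
Definition has_cycle (T : finType) (e : rel T) (k : nat) : Prop :=
  exists c : k.-tuple T, ucycle e c.

Definition delta_circ (d : nat) : int :=
  (if odd d then 2 * d%:Z ^+ 2 - 5 * d%:Z + 7
            else 2 * d%:Z ^+ 2 - 5 * d%:Z + 5)%R.

(* Main.v *)
(** The vertices within distance 2 of an edge number at least [delta_circ]. Take
    a maximal set M of edges whose 2-balls are pairwise disjoint and which is
    connected for the relation "at distance at most 5"; by maximality every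
    vertex lies within distance 5 of M. Assign each vertex to an edge of M near
    it, so that every fibre contains the 2-ball of its edge. Let p_0, ..., p_d be
    a longest path of the graph H on M. A path leaving it at p_j has length at
    most min(j, d - j), so p_i has eccentricity at most max(i, d - i) in H and
    every vertex of H at most d. A step of H costs at most 6 in the original
    graph, so the eccentricity of a vertex assigned to f is at most
    6 ecc_H(f) + 11. Since each p_i carries at least [delta_circ] vertices, summing
    gives the bound. *)

Require Import Defs.
From mathcomp Require Import all_boot all_order all_algebra zify lra.
Set Implicit Arguments.
Unset Strict Implicit.
Unset Printing Implicit Defensive.
Import Order.TTheory GRing.Theory Num.Theory.

(** * Walks of bounded length *)

Section Walks.
Variables (T : finType) (e : rel T).

(** Stands for a walk of at most [k] edges, repeated vertices allowed. Only upper bounds on [gdist]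
    are needed, and these suffice for them. *)
Fixpoint within (k : nat) : rel T := fun x y =>
  if k is k'.+1 then within k' x y || [exists z, e x z && within k' z y]
  else x == y.

Lemma withinP k x y :
  reflect (exists p, [/\ path e x p, last x p = y & size p <= k])
          (within k x y).
Proof.
apply: (iffP idP).
  elim: k x => [|k IH] x /=; first by move/eqP=> <-; exists [::].
  case/orP=> [/IH [p [xp yp sp]]|/existsP [z /andP [xz /IH [p [zp yp sp]]]]].
    by exists p; split=> //; lia.
  by exists (z :: p); rewrite /= xz zp; split.
elim: k x => [|k IH] x [p [xp yp sp]] /=.
  by case: p xp yp sp => //= _ ->.
case: p xp yp sp => [|z p] /= => [_ xy _|/andP [xz zp] yp sp].
  by rewrite IH //; exists [::].
apply/orP; right; apply/existsP; exists z; rewrite xz /=.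
by apply: IH; exists p.
Qed.

Lemma within_refl k x : within k x x.
Proof. by apply/withinP; exists [::]. Qed.

Lemma within_edge k x y : e x y -> within k.+1 x y.
Proof. by move=> xy; apply/withinP; exists [:: y]; rewrite /= xy. Qed.

Lemma within_mono j k x y : j <= k -> within j x y -> within k x y.
Proof.
move=> jk /withinP [p [xp yp sp]]; apply/withinP; exists p; split=> //.
exact: leq_trans jk.
Qed.

Lemma within_trans j k x y z :
  within j x y -> within k y z -> within (j + k) x z.
Proof.
move=> /withinP [p [xp yp sp]] /withinP [q [yq zq sq]]; apply/withinP.
exists (p ++ q); rewrite cat_path last_cat xp yp yq zq size_cat.
by split=> //; apply: leq_add.
Qed.

Lemma gdist_within k x y : within k x y -> gdist e x y <= k.
Proof.
move=> /withinP [p [xp yp sp]]; apply: leq_trans sp; rewrite /gdist.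
set a := fun _ => _; set s := iota _ _.
(* With [#|T|] edges or more the bound is trivial: [find] never exceeds the length of its list. *)
have [lt|ge] := ltnP (size p) #|T|; last first.
  by apply: leq_trans ge; rewrite -[X in _ <= X](size_iota 0) find_size.
rewrite leqNgt; apply/negP=> /(before_find 0).
rewrite nth_iota // add0n {}/a => /existsP [].
by exists (in_tuple p); rewrite xp yp eqxx.
Qed.

Hypothesis e_sym : symmetric e.

Lemma within_sym k : symmetric (within k).
Proof.
suff S x y : within k x y -> within k y x by move=> x y; apply/idP/idP; apply: S.
move=> /withinP [p [xp yp sp]]; apply/withinP; exists (rev (belast x p)).
rewrite -yp rev_path (eq_path (e' := e)) ?xp; last by move=> u v; apply: e_sym.
split=> //; last by rewrite size_rev size_belast.
by case: p {xp yp sp} => [|z p] //=; rewrite rev_cons last_rcons.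
Qed.

End Walks.

Arguments within : simpl never.

(** * Longest paths *)

Section LongestPath.
Variables (T : finType) (h : rel T).
Hypothesis h_sym : symmetric h.

Definition longest_path (P : seq T) :=
  [/\ sorted h P, uniq P
    & forall s : seq T, sorted h s -> uniq s -> size s <= size P].

(** The last clause is meant for [hop M], which lives on all pairs but joins only members of [M]:
    for [x] in [M] it keeps the whole path inside [M]. *)
Lemma longest_path_exists (x : T) : exists P,
  [/\ longest_path P, 0 < size P
    & forall y, y \in P -> y = x \/ exists z, h y z].
Proof.
pose a n := [exists p : n.-tuple T, sorted h p && uniq p].
have aP s : sorted h s -> uniq s -> a (size s).
  by move=> hs us; apply/existsP; exists (in_tuple s); rewrite hs us.
have a1 : exists n, a n by exists 1; apply: (aP [:: x]).
have aB n : a n -> n <= #|T|.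
  by case/existsP=> p /andP [_ /card_uniqP pE]; rewrite -(size_tuple p) -pE max_card.
case: (ex_maxnP a1 aB) => n /existsP [p /andP [hp up]] nmax.
have {}nmax s : sorted h s -> uniq s -> size s <= n by move=> hs us; apply/nmax/aP.
(* If no path has two vertices, the single vertex has to be [x] itself. *)
have [n1|n_gt1] := leqP n 1.
  exists [:: x]; split=> // [|y]; last by rewrite inE => /eqP; left.
  by split=> // s hs us; apply: leq_trans n1; apply: nmax.
exists p; rewrite size_tuple; split; [|exact: ltnW|].
  by split=> // s hs us; rewrite size_tuple; apply: nmax.
move=> y yp; right; move: hp (size_tuple p).
case/splitPr: yp => p1 [|z p2]; last first.
  by rewrite sorted_cat_cons /= => /and3P [_ yz _] _; exists z.
case: p1 => [|z p1]; first by move=> _ /= E; rewrite -E in n_gt1.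
rewrite /= cat_path /= => /and3P [_ zy _] _.
by exists (last z p1); rewrite h_sym.
Qed.

Lemma sorted_rev s : sorted h (rev s) = sorted h s.
Proof. by rewrite rev_sorted; apply: eq_sorted => x y; rewrite /= h_sym. Qed.

Lemma longest_path_rev P : longest_path P -> longest_path (rev P).
Proof. by case=> hP uP maxP; split; rewrite ?sorted_rev ?rev_uniq ?size_rev. Qed.

(* Otherwise s would replace p1 in a longer path. *)
Lemma longest_path_branch s y p1 p2 :
    longest_path (p1 ++ y :: p2) -> sorted h (rcons s y) -> uniq (rcons s y) ->
    (forall z, z \in s -> z \notin p1 ++ y :: p2) ->
  size s <= size p1.
Proof.
case=> hP uP maxP hs us sP.
have := maxP (s ++ y :: p2); rewrite !size_cat leq_add2r; apply.
  by move: hP; rewrite !sorted_cat_cons hs => /andP [].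
move: us uP; rewrite rcons_uniq !cat_uniq => /andP [ys ->] /and3P [_ _ ->].
rewrite andbT /= negb_or ys; apply/hasPn=> z zp2; apply/negP=> /sP.
by rewrite mem_cat inE [z \in p2]zp2 !orbT.
Qed.

(** Cut a simple path from [f] to [P] at its first vertex on [P]. The piece before it avoids [P], so
    [longest_path_branch], applied to [P] and to its reverse, bounds its length from both ends. *)
Lemma longest_path_dist P f x0 : longest_path P -> 0 < size P ->
    (forall x, x \in P -> connect h f x) ->
  exists j, j < size P
    /\ within h (minn j ((size P).-1 - j)) f (nth x0 P j).
Proof.
move=> lP P_gt0 conn.
have /connectP [q hq xq] : connect h f (nth x0 P 0) by apply/conn/mem_nth.
case/shortenP: hq xq => p hp up _ xp.
have hasP : has (mem P) (f :: p).
  by apply/hasP; exists (last f p); rewrite ?mem_last // -xp; apply: mem_nth.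
have [s1 [y [s2 [sE yP s1P]]]] : exists s1 y s2,
    [/\ f :: p = rcons s1 y ++ s2, y \in P & ~~ has (mem P) s1].
  by case/(split_find_nth x0): hasP => y s1 s2 yP s1P; exists s1, y, s2.
have [hs us] : sorted h (rcons s1 y) /\ uniq (rcons s1 y).
  have: sorted h (f :: p) by [].
  rewrite sE => /cat_sorted2 [-> _]; split=> //.
  by move: up; rewrite sE cat_uniq => /and3P [].
have s1P' z : z \in s1 -> z \notin P by move=> zs; apply: (hasPn s1P).
exists (index y P); rewrite index_mem nth_index //; split=> //.
have fy : within h (size s1) f y.
  apply/withinP; case: (s1) sE hs => [|g s1''] /= [-> _] hs; first by exists [::].
  by exists (rcons s1'' y); rewrite last_rcons size_rcons.
apply: within_mono fy; rewrite leq_min.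
case/splitPr: yP lP s1P' => p1 p2 lP s1P'.
have: y \notin p1.
  by case: lP => _; rewrite cat_uniq => /and3P [_ /hasPn /(_ y)]; rewrite mem_head => ->.
rewrite index_cat => /negPf -> /=; rewrite eqxx size_cat /= addn0.
apply/andP; split; first exact: longest_path_branch lP hs us s1P'.
rewrite (_ : _ - _ = size (rev p2)); last by rewrite size_rev addnS addKn.
move/longest_path_rev: lP; rewrite rev_cat rev_cons cat_rcons => lP.
apply: longest_path_branch lP hs us _ => z /s1P'.
by rewrite !(mem_cat, inE, mem_rev) !negb_or => /and3P [-> -> ->].
Qed.

(** Walk via [P], with d its length: |i-j| + min(j, d-j) <= max(i, d-i), and adding min(i, d-i) for
    a start off [P] gives at most d. *)
Lemma longest_path_ecc P f g (x0 : T) : longest_path P -> 0 < size P ->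
    (forall x, x \in P -> connect h f x) ->
    (forall x, x \in P -> connect h g x) ->
  within h (if f \in P then maxn (index f P) ((size P).-1 - index f P)
            else (size P).-1) f g.
Proof.
move=> lP P_gt0 fP gP.
have walk i j : i <= j < size P -> within h (j - i) (nth x0 P i) (nth x0 P j).
  case/andP=> /subnKC <-; rewrite addKn; elim: (j - i) => [|k IH] lt.
    by rewrite addn0 within_refl.
  rewrite -addn1; apply: (within_trans (IH _)); first lia.
  apply: within_edge; rewrite addn1 addnS.
  by case: lP => /(sortedP x0) hP _ _; apply: hP; lia.
have walk' i j : i < size P -> j < size P ->
    within h (maxn i j - minn i j) (nth x0 P i) (nth x0 P j).
  move=> iP jP; have [ij|ji] := leqP i j; first by apply: walk; lia.
  by rewrite within_sym //; apply: walk; lia.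
have [j [jP gj]] := longest_path_dist x0 lP P_gt0 gP.
case: ifP => [fP'|_].
  have iP : index f P < size P by rewrite index_mem.
  have := within_trans (walk' _ _ iP jP) (etrans (within_sym h_sym _ _ _) gj).
  by rewrite nth_index //; apply: within_mono; lia.
have [i [iP fi]] := longest_path_dist x0 lP P_gt0 fP.
have := within_trans (within_trans fi (walk' _ _ iP jP))
                     (etrans (within_sym h_sym _ _ _) gj).
by apply: within_mono; lia.
Qed.

End LongestPath.

(** * The 2-ball of an edge *)

Lemma cardsU_disjoint (T : finType) (A B : {set T}) :
  [disjoint A & B] -> #|A :|: B| = #|A| + #|B|.
Proof. by move/disjoint_setI0 => AB; rewrite cardsU AB cards0 subn0. Qed.

(** Strong induction on the size of [X], deleting one orbit {x, f x} at a time. *)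
Lemma involution_even (T : finType) (f : T -> T) (X : {set T}) :
    (forall x, x \in X -> [/\ f x \in X, f x != x & f (f x) = x]) ->
  ~~ odd #|X|.
Proof.
have [n] := ubnP #|X|; elim: n X => // n IH X ltn fX.
have [->|[x xX]] := set_0Vmem X; first by rewrite cards0.
have [fxX fxx ffx] := fX x xX.
have E : #|X| = #|X :\ x :\ f x|.+2.
  by rewrite (cardsD1 x) xX (cardsD1 (f x) (X :\ x)) !inE fxx fxX.
rewrite E /= negbK; apply: IH => [|y]; first by move: ltn; rewrite E; lia.
rewrite !inE => /and3P [yfx yx yX]; have [fyX fyy ffy] := fX y yX.
rewrite fyX fyy ffy; split=> //; rewrite andbT; apply/andP; split.
  by apply: contraNneq yx => fyfx; rewrite -ffy fyfx ffx.
by apply: contraNneq yfx => <-; rewrite ffy.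
Qed.

Lemma sum_card_bigcup (T I : finType) (X : {set I}) (F : I -> {set T}) :
    {in X &, forall i j, i != j -> [disjoint F i & F j]} ->
  \sum_(i in X) #|F i| <= #|\bigcup_(i in X) F i|.
Proof.
(* Emptying the sets outside [X] makes the family disjoint over all indices. *)
move=> dF; pose G i := if i \in X then F i else set0.
rewrite (big_mkcond (mem X) F) /= -[X in _ <= X]sum1_card.
rewrite (@partition_disjoint_bigcup _ _ _ 0 _ G) => [|i j ij].
  rewrite big_mkcond leq_sum // => i _; rewrite /G sum1_card.
  by case: ifP; rewrite ?cards0.
rewrite /G; case: ifP => iX; last by rewrite -setI_eq0 set0I.
by case: ifP => jX; [apply: dF | rewrite -setI_eq0 setI0].
Qed.

(** * Neighbourhood counts without 4-cycles and 5-cycles *)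

Section Counting.
Variables (T : finType) (e : rel T).
Hypotheses (e_sym : symmetric e) (e_irr : irreflexive e).

(** Otherwise x z y w is a 4-cycle. Distinct vertices thus share at most one neighbour. *)
Lemma noC4_false : ~ has_cycle e 4 -> forall x y z w,
  x != y -> z != w -> e x z -> e y z -> e x w -> e y w -> False.
Proof.
move=> noC4 x y z w xy zw xz yz xw yw; apply: noC4.
have ne a b : e a b -> a != b by apply: contraTneq => ->; rewrite e_irr.
exists [tuple x; z; y; w]; rewrite /ucycle /= xz e_sym yz yw e_sym xw /= !inE.
by rewrite !negb_or xy zw ne // ne // eq_sym ne // ne.
Qed.

Lemma noC5_false : ~ has_cycle e 5 -> forall a b c d f, uniq [:: a; b; c; d; f] ->
  e a b -> e b c -> e c d -> e d f -> e f a -> False.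
Proof.
move=> noC5 a b c d f un ab bc cd df fa; apply: noC5.
by exists [tuple a; b; c; d; f]; rewrite /ucycle un /= ab bc cd df fa.
Qed.

Lemma min_degree_le v : min_degree e <= degree e v.
Proof.
rewrite /min_degree; elim: (index_enum T) (mem_index_enum v) => // x s IH.
rewrite inE big_cons geq_min => /orP [/eqP ->|/IH ->]; first by rewrite leqnn.
exact: orbT.
Qed.

Variable d : nat.
Hypotheses (noC4 : ~ has_cycle e 4) (noC5 : ~ has_cycle e 5).
Hypothesis deg : forall v, d <= degree e v.

Definition nbh x := [set y | e x y].
(* Neighbours of x at distance 2 from u, when x is adjacent to u. *)
Definition far u x := nbh x :\: (u |: nbh u).
(** For [X] inside [nbh u], the part of the 2-ball of [u] reached through [X]; since [far] omits
    neighbours of [u], the two layers are disjoint. *)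
Definition branch u X := X :|: \bigcup_(x in X) far u x.

Lemma card_common u x : u != x -> #|nbh x :&: nbh u| <= 1.
Proof.
move=> ux; apply/card_le1_eqP=> y z; rewrite !inE => /andP [xy uy] /andP [xz uz].
by apply: contraTeq isT => yz; case: (noC4_false noC4 ux yz).
Qed.

(** Each neighbour of [x] is far, shared with [u], or [u] itself. *)
Lemma card_far u x : e u x -> d <= #|far u x| + #|nbh x :&: nbh u| + 1.
Proof.
move=> ux; apply: leq_trans (deg x) _; rewrite /degree -/(nbh x).
rewrite /far -(cardsID (u |: nbh u) (nbh x)) addnC -addnA leq_add2l addn1.
rewrite setIUr; apply: leq_trans (leq_card_setU _ _) _.
rewrite addnC -addn1 leq_add2l; apply: leq_trans (subset_leq_card (subsetIr _ _)) _.
by rewrite cards1.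
Qed.

(* As C4 is excluded, the graph induced on the neighbours of u has maximum degree
   1: a set of odd size closed in it contains an isolated vertex x, for which
   [far u x] has one element more. *)
Lemma card_branch_ge u (X : {set T}) t :
    X \subset nbh u -> (forall x, x \in X -> nbh x :&: nbh u \subset X) ->
    t <= #|X| -> 2 <= d ->
  t * d.-1 + odd t <= #|branch u X|.
Proof.
move=> Xu Xcl tX d_ge2; have eX x : x \in X -> e u x.
  by move=> /(subsetP Xu); rewrite inE.
have ne x : x \in X -> u != x by move/eX; apply: contraTneq => ->; rewrite e_irr.
(* Each [x] with its far set contributes at least d - 1, and d if it is isolated. The far sets are
   disjoint: a shared vertex and [u] would be two common neighbours. *)
have S : #|X| * d.-1 + #|[set x in X | nbh x :&: nbh u == set0]| <= #|branch u X|.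
  rewrite /branch cardsU disjoint_setI0 ?cards0 ?subn0; last first.
    apply: bigcup_disjoint => x _; rewrite disjoint_subset.
    by apply/subsetP=> y /eX uy; rewrite !inE uy orbT.
  apply: leq_trans (leq_add (leqnn _) (sum_card_bigcup _)); last first.
    move=> x y xX yX xy; rewrite disjoint_subset; apply/subsetP=> z.
    rewrite !inE !negb_or !negb_and !negbK => /andP [/andP [zu _] xz].
    apply/orP; right; apply/negP=> yz.
    by apply: (noC4_false noC4 xy zu xz yz); rewrite e_sym eX.
  rewrite -sum1_card -sum1dep_card big_mkcondr -big_split /= big_distrl /= -big_split /=.
  apply: leq_sum => x xX; have := card_far (eX x xX); have := card_common (ne x xX).
  by rewrite -cards_eq0; case: eqP => [->|]; lia.
(* A surplus vertex contributes d - 1 >= 1, which covers the parity term. *)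
have [ltX|geX] := ltnP t #|X|.
  apply: leq_trans S; apply: leq_trans (leq_addr _ _).
  by apply: (@leq_trans (t.+1 * d.-1)); [case: odd; lia|rewrite leq_mul2r ltX orbT].
have E : #|X| = t by apply/eqP; rewrite eqn_leq geX.
apply: leq_trans S; rewrite E leq_add2l; case: (boolP (odd t)) => //= todd.
rewrite card_gt0; apply/set0Pn.
have [/exists_inP [x xX x0]|/exists_inPn all] :=
  boolP [exists x in X, nbh x :&: nbh u == set0].
  by exists x; rewrite inE xX.
(* Without an isolated vertex, sending [x] to its common neighbour with [u] is a fixed-point-free
   involution of [X], against odd size. *)
pose f x := odflt x [pick y in nbh x :&: nbh u].
have fP x : x \in X -> f x \in nbh x :&: nbh u.
  rewrite /f; case: pickP => [y //|none] /all /set0Pn [y].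
  by rewrite none.
have := @involution_even T f X; rewrite E todd => F; suff: false by []; apply: F => x xX.
have fxX := subsetP (Xcl x xX) _ (fP x xX); have := fP _ xX; have := fP _ fxX.
rewrite !inE => /andP [ffx uff] /andP [xf uf]; split=> //.
  by apply: contraTneq xf => ->; rewrite e_irr.
apply/eqP; apply: contraT => ffxx; case: (noC4_false noC4 (ne _ fxX) ffxx) => //.
  exact: eX.
by rewrite e_sym.
Qed.

Definition ball2 u v := [set x | within e 2 u x || within e 2 v x].

Lemma within_path2 u x z : e u x -> e x z -> within e 2 u z.
Proof. by move=> ux xz; apply/withinP; exists [:: x; z]; rewrite /= ux xz. Qed.

Lemma branchP u (X : {set T}) z : reflect
  (z \in X \/ exists2 x, x \in X & [/\ e x z, z != u & ~~ e u z])
  (z \in branch u X).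
Proof.
rewrite inE; apply: (iffP orP) => -[]; try by left.
  by case/bigcupP=> x xX; rewrite !inE negb_or => /andP [/andP [? ?] ?]; right; exists x.
by case=> x xX [xz zu uz]; right; apply/bigcupP; exists x; rewrite // !inE negb_or zu uz.
Qed.

(** An edge between [X] and [Y] closes a 4-cycle u x y v; a vertex z in both second layers closes a
    5-cycle u x z y v. *)
Lemma disjoint_branch u v (X Y : {set T}) : e u v ->
    X \subset nbh u -> Y \subset nbh v ->
    (forall x, x \in X -> ~~ e v x /\ x != v) ->
    (forall y, y \in Y -> ~~ e u y /\ y != u) ->
  [disjoint branch u X & branch v Y].
Proof.
move=> uv /subsetP Xu /subsetP Yv Xv Yu.
have {}Xu x : x \in X -> e u x by move/Xu; rewrite inE.
have {}Yv y : y \in Y -> e v y by move/Yv; rewrite inE.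
have adj x y : x \in X -> y \in Y -> ~~ e x y.
  move=> xX yY; have [vx xv] := Xv x xX; have [uy yu] := Yu y yY.
  apply/negP=> xy; rewrite eq_sym in yu.
  by apply: (noC4_false noC4 yu xv (Xu _ xX) _ uv); rewrite e_sym // Yv.
rewrite disjoint_subset; apply/subsetP=> z /branchP zX; apply/negP=> /branchP zY.
case: zX zY => [zX|[x xX [xz zu uz]]] [zY|[y yY [yz zv vz]]].
- by case: (Xv z zX); rewrite Yv.
- by have := adj _ _ zX yY; rewrite e_sym yz.
- by have := adj _ _ xX zY; rewrite xz.
have [vx xv] := Xv x xX; have [uy yu] := Yu y yY.
have zy : e z y by rewrite e_sym.
have yv : e y v by rewrite e_sym Yv.
have vu : e v u by rewrite e_sym.
apply: (noC5_false noC5 _ (Xu _ xX) xz zy yv vu).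
have ne a b : e a b -> a != b by apply: contraTneq => ->; rewrite e_irr.
have xy : x != y by apply: contraNneq uy => <-; apply: Xu.
have yz' : z != y by rewrite eq_sym ne.
have vy : y != v by rewrite eq_sym ne ?Yv.
have uy' : u != y by rewrite eq_sym.
have uz' : u != z by rewrite eq_sym.
by rewrite /= !inE !negb_or xv zv xy yz' vy uy' uz' (ne _ _ uv) (ne _ _ xz) (ne _ _ (Xu _ xX)).
Qed.

(* [delta_circ] as a natural number; the subtraction is exact. *)
Definition dcirc := (if odd d then 2 * d ^ 2 + 7 - 5 * d
                     else 2 * d ^ 2 + 5 - 5 * d)%N.

(** The count shared by both cases of [card_ball2]: two disjoint branches, and a set [R] for the
    rest. *)
Lemma card_ball2_ge u v (X Y R : {set T}) t : e u v -> 2 <= d ->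
    X \subset nbh u -> Y \subset nbh v ->
    (forall x, x \in X -> ~~ e v x /\ x != v) ->
    (forall y, y \in Y -> ~~ e u y /\ y != u) ->
    (forall x, x \in X -> nbh x :&: nbh u \subset X) ->
    (forall y, y \in Y -> nbh y :&: nbh v \subset Y) ->
    t <= #|X| -> t <= #|Y| ->
    R \subset ball2 u v -> [disjoint R & branch u X] ->
    [disjoint R & branch v Y] ->
  2 * (t * d.-1 + odd t) + #|R| <= #|ball2 u v|.
Proof.
move=> uv d2 Xu Yv Xv Yu Xcl Ycl tX tY RB RX RY.
have bX := card_branch_ge Xu Xcl tX d2; have bY := card_branch_ge Yv Ycl tY d2.
have bsub a (Z : {set T}) : Z \subset nbh a -> (branch a Z \subset [set x | within e 2 a x]).
  move=> /subsetP Za; apply/subsetP=> z /branchP [/Za|[x /Za + [xz _ _]]]; rewrite !inE.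
    exact: within_edge.
  by move=> ax; apply: within_path2 xz.
have sub : branch u X :|: branch v Y :|: R \subset ball2 u v.
  rewrite subUset RB andbT subUset; apply/andP; split.
    by apply: subset_trans (bsub _ _ Xu) _; apply/subsetP=> z; rewrite !inE => ->.
  by apply: subset_trans (bsub _ _ Yv) _; apply/subsetP=> z; rewrite !inE orbC => ->.
apply: leq_trans (subset_leq_card sub).
rewrite cardsU_disjoint; last first.
  by rewrite disjoint_sym disjoints_subset setCU subsetI -!disjoints_subset RX.
rewrite cardsU_disjoint; last exact: disjoint_branch.
by rewrite leq_add2r mul2n -addnn leq_add.
Qed.

(** If uv lies in a triangle, t = d - 2 and |R| >= d + 1 give exactly [dcirc]. Otherwise t = d - 1
    and |R| = 2 give 2(d-1)^2 + 2, plus 2 for even d; for odd d this reaches [dcirc] because d >=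
    3. *)
Lemma card_ball2 u v : 3 <= d -> e u v -> dcirc <= #|ball2 u v|.
Proof.
move=> d3 uv; have d2 : 2 <= d by lia.
have ne a b : e a b -> a != b by apply: contraTneq => ->; rewrite e_irr.
have vu : e v u by rewrite e_sym.
have du : d <= #|nbh u| := deg u; have dv : d <= #|nbh v| := deg v.
have uB : u \in ball2 u v by rewrite inE within_refl.
have vB : v \in ball2 u v by rewrite inE within_refl orbT.
(* C4 excludes a second common neighbour. *)
have [/existsP [w /andP [uw vw]]|/existsPn none] := boolP [exists w, e u w && e v w].
  have wu : e w u by rewrite e_sym.
  have wv : e w v by rewrite e_sym.
  have adj a b : e a b -> e a w -> e b w ->
      forall x, x \in nbh a :\ b :\ w -> ~~ e b x /\ x != b.
    move=> ab aw bw x; rewrite !inE => /and3P [xw xb ax]; split=> //.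
    by apply/negP=> bx; apply: (noC4_false noC4 (ne _ _ ab) xw ax bx aw bw).
  have cl a b : e a b -> e a w -> e b w ->
      forall x, x \in nbh a :\ b :\ w -> nbh x :&: nbh a \subset nbh a :\ b :\ w.
    move=> ab aw bw x xX; have [bx xb] := adj a b ab aw bw x xX.
    move: xX; rewrite !inE => /and3P [xw _ ax].
    apply/subsetP=> y; rewrite !inE => /andP [xy ay]; rewrite ay andbT.
    apply/andP; split; last by apply: contraNneq bx => <-; rewrite e_sym.
    apply/eqP=> yw; rewrite yw in xy ay.
    apply: (noC4_false noC4 (ne _ _ aw) xb ax _ ab _); rewrite e_sym //.
  have sz a b : e a b -> e a w -> e b w -> d <= #|nbh a| -> d - 2 <= #|nbh a :\ b :\ w|.
    move=> ab aw bw; rewrite (cardsD1 b) (cardsD1 w (nbh a :\ b)) !inE ab aw.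
    by rewrite eq_sym (ne _ _ bw) leq_subLR.
  (* The third triangle vertex is cut from both branches and counted here with its own neighbours: 3
     + (d - 2). *)
  pose W := nbh w :\ u :\ v; pose R := [set u; v; w] :|: W.
  have cR : d + 1 <= #|R|.
    rewrite cardsU_disjoint; last first.
      rewrite disjoint_sym disjoints_subset; apply/subsetP=> z; rewrite !inE => /and3P [zv zu wz].
      by rewrite !negb_or zv zu eq_sym ne.
    rewrite -setUA !cardsU1 cards1 !inE negb_or (ne _ _ uv) (ne _ _ uw) (ne _ _ vw) /=.
    have dw : d <= #|nbh w| := deg w.
    move: dw; rewrite (cardsD1 u) (cardsD1 v (nbh w :\ u)) !inE wu wv -/W.
    by rewrite ne //=; lia.
  have RB : R \subset ball2 u v.
    apply/subsetP=> z zR; rewrite inE.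
    have: [|| z == u, z == v, z == w | z \in W] by move: zR; rewrite !inE -!orbA.
    case/or4P=> [/eqP ->|/eqP ->|/eqP ->|].
    - by rewrite within_refl.
    - by rewrite within_refl orbT.
    - by rewrite within_edge.
    by rewrite !inE => /and3P [_ _ wz]; rewrite (within_path2 uw wz).
  (* A branch vertex z adjacent to [w] closes a 4-cycle: a z w b if it is in the first layer, a x z
     w if it is reached through x. *)
  have RX a b : e a b -> e a w -> e b w -> (a == u) && (b == v) || (a == v) && (b == u) ->
      [disjoint R & branch a (nbh a :\ b :\ w)].
    move=> ab aw bw abuv; have {abuv}RE : R = [set a; b; w] :|: nbh w :\ a :\ b.
      case/orP: abuv => /andP [/eqP -> /eqP ->] //.
      by apply/setP=> z; rewrite !inE; do !case: (_ == _); case: (e _ _).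
    rewrite RE disjoint_sym disjoint_subset; apply/subsetP=> z /branchP zX.
    apply/negP; rewrite !inE -!orbA; case: zX => [|[x]].
      rewrite !inE => /and3P [zw zb az]; rewrite (negPf zw) (negPf zb).
      rewrite eq_sym (negPf (ne _ _ az)) /= => wz.
      apply: (noC4_false noC4 (ne _ _ aw) zb az wz ab _); rewrite e_sym //.
    rewrite !inE => /and3P [xw xb ax] [xz za naz].
    case/or4P=> [|/eqP zb|/eqP zw|/and3P [_ _ wz]].
    - by rewrite (negPf za).
    - by rewrite zb ab in naz.
    - by rewrite zw aw in naz.
    by apply: (noC4_false noC4 za xw _ ax _ aw); rewrite e_sym.
  have sN a b : nbh a :\ b :\ w \subset nbh a.
    exact: subset_trans (subD1set _ _) (subD1set _ _).
  have := card_ball2_ge uv d2 (sN u v) (sN v u) (adj u v uv uw vw) (adj v u vu vw uw)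
    (cl u v uv uw vw) (cl v u vu vw uw) (sz u v uv uw vw du) (sz v u vu vw uw dv)
    RB (RX u v uv uw vw _) (RX v u vu vw uw _).
  rewrite !eqxx orbT => /(_ isT isT); apply: leq_trans; rewrite /dcirc.
  have -> : odd (d - 2) = odd d by rewrite oddB ?addbF.
  by case: odd; nia.
have adj a b : (forall x, ~~ (e a x && e b x)) ->
    forall x, x \in nbh a :\ b -> ~~ e b x /\ x != b.
  by move=> nab x; rewrite !inE => /andP [-> ax]; have := nab x; rewrite ax.
have cl a b : (forall x, ~~ (e a x && e b x)) -> 
    forall x, x \in nbh a :\ b -> nbh x :&: nbh a \subset nbh a :\ b.
  move=> nab x xX; have [bx xb] := adj a b nab x xX.
  apply/subsetP=> y; rewrite !inE => /andP [xy ->]; rewrite andbT.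
  by apply: contraNneq bx => <-; rewrite e_sym.
have none' x : ~~ (e v x && e u x) by rewrite andbC.
have sz a b : e a b -> d <= #|nbh a| -> d - 1 <= #|nbh a :\ b|.
  by move=> ab; rewrite (cardsD1 b) !inE ab; lia.
have RX a b : e a b -> [disjoint [set a; b] & branch a (nbh a :\ b)].
  move=> ab; rewrite disjoint_sym disjoint_subset; apply/subsetP=> z /branchP zX.
  rewrite !inE negb_or; case: zX => [|[x _ [_ -> naz]]].
    by rewrite !inE => /andP [-> az]; rewrite eq_sym ne.
  by apply: contraNneq naz => ->.
have RB : [set u; v] \subset ball2 u v by rewrite subUset !sub1set uB.
have := card_ball2_ge uv d2 (subD1set _ v) (subD1set _ u) (adj u v none) (adj v u none')
    (cl u v none) (cl v u none') (sz u v uv du) (sz v u vu dv) RB (RX u v uv) _.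
rewrite setUC RX // cards2 eq_sym ne // => /(_ isT); apply: leq_trans; rewrite /dcirc.
have -> : odd (d - 1) = ~~ odd d by rewrite oddB ?addbT //; lia.
by case: odd => /=; nia.
Qed.

End Counting.

(** * Packing of edges *)

(** The sum is floor(d^2/4). From d to d + 2 the two end terms are zero and each of the d + 1 inner
    terms is one larger than before. *)
Lemma sum_minn_ge d : d ^ 2 <= 4 * (\sum_(i < d.+1) minn i (d - i)) + 1.
Proof.
have [n] := ubnP d; elim: n d => // n IH [|[|d]] // ltn; first exact: leq_addl.
have -> : \sum_(i < d.+3) minn i (d.+2 - i) = \sum_(i < d.+1) minn i (d - i) + d.+1.
  rewrite big_ord_recl big_ord_recr /= -[X in _ = _ + X](card_ord d.+1) -sum1_card.
  rewrite -big_split /= /bump min0n add0n -[RHS]addn0; congr (_ + _); last lia.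
  by apply: eq_bigr => i _; have := ltn_ord i; lia.
have := IH d ltac:(lia); move: (\sum_(i < _) _) => S; lia.
Qed.

(** With m = 1 this bounds the length of the path; with m = min(i, d-i) it bounds the saving in the
    eccentricity sum. *)
Lemma sum_fibers_ge (T U : finType) (a : T -> U) (P : seq U) (m : U -> nat) D :
    uniq P -> (forall f, f \in P -> D <= #|[set v | a v == f]|) ->
  D * (\sum_(f <- P) m f) <= \sum_(v | a v \in P) m (a v).
Proof.
move=> uP DP; rewrite (partition_big a (mem P)) //= -big_uniq //= big_distrr /=.
rewrite big_seq [X in _ <= X]big_seq leq_sum // => f fP.
rewrite (eq_bigr (fun=> m f)) => [|v /andP [_ /eqP ->]] //.
rewrite sum_nat_const leq_mul2r; apply/orP; right.
apply: leq_trans (DP f fP) _; apply/subset_leq_card/subsetP=> v.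
by rewrite !inE => /eqP vf; rewrite unfold_in /= vf fP eqxx.
Qed.

Section Packing.
Variables (T : finType) (e : rel T).
Hypotheses (e_sym : symmetric e) (e_conn : forall x y, connect e x y).
Implicit Types (f g : T * T) (M : {set T * T}).

Definition near k f x := within e k f.1 x || within e k f.2 x.
(** The graph H on [M]. Membership is built in so that walks from [M] stay in [M]. *)
Definition hop M f g :=
  [&& f \in M, g \in M & near 5 f g.1 || near 5 f g.2].

(** Edges are ordered pairs; disjointness excludes the two orientations of one edge. The boolean
    form allows a maximal packing to be taken. *)
Definition packing M :=
  [&& [forall f in M, e f.1 f.2],
      [forall f in M, forall g in M,
         (f != g) ==> [disjoint ball2 e f.1 f.2 & ball2 e g.1 g.2]]
    & [forall f in M, forall g in M, connect (hop M) f g]].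

Lemma packingP M : reflect
  [/\ forall f, f \in M -> e f.1 f.2,
      forall f g x, f \in M -> g \in M -> near 2 f x -> near 2 g x -> f = g
    & forall f g, f \in M -> g \in M -> connect (hop M) f g]
  (packing M).
Proof.
apply: (iffP and3P) => -[eM dM cM]; split.
- exact/forall_inP.
- move=> f g x fM gM fx gx; apply: contraTeq isT => fg.
  have /implyP /(_ fg) := forall_inP (forall_inP dM f fM) g gM.
  rewrite disjoint_subset => /subsetP /(_ x); rewrite !inE => /(_ fx).
  by rewrite -/(near 2 g x) gx.
- by move=> f g fM; apply/forall_inP; move: f fM; apply/forall_inP.
- exact/forall_inP.
- apply/forall_inP=> f fM; apply/forall_inP=> g gM; apply/implyP=> fg.
  rewrite disjoint_subset; apply/subsetP=> x; rewrite !inE => fx.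
  by apply: contraNN fg => gx; apply/eqP/(dM f g x).
by apply/forall_inP=> f fM; apply/forall_inP=> g gM; apply: cM.
Qed.

Lemma nearP k f x :
  reflect (exists2 a, a = f.1 \/ a = f.2 & within e k a x) (near k f x).
Proof.
apply: (iffP orP) => [[]|[a [->|->]]]; [exists f.1|exists f.2|left|right] => //.
  by left.
by right.
Qed.

Lemma hop_sym M : symmetric (hop M).
Proof.
move=> f g; rewrite /hop /near !(within_sym e_sym _ f.1) !(within_sym e_sym _ f.2).
by rewrite andbCA orbACA.
Qed.

Lemma near_trans j k f x y : near j f x -> within e k x y -> near (j + k) f y.
Proof.
by case/nearP=> a fa ax xy; apply/nearP; exists a => //; apply: within_trans xy.
Qed.

Lemma near_mono j k f x : j <= k -> near j f x -> near k f x.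
Proof.
move=> jk /nearP [a fa ax]; apply/nearP; exists a => //; exact: within_mono ax.
Qed.

(** Meeting 2-balls would put [x] or [y] within 2 + 2 of some [g]; the hop from [f] keeps the
    packing connected. *)
Lemma packing_add M x y f : packing M -> e x y -> f \in M -> near 5 f x ->
    (forall g, g \in M -> ~~ near 4 g x /\ ~~ near 4 g y) ->
  packing ((x, y) |: M).
Proof.
move=> /packingP [eM dM cM] xy fM fx far; apply/packingP.
have dis g z : g \in M -> near 2 g z -> near 2 (x, y) z -> false.
  move=> /far [/negP gx /negP gy] gz; rewrite /near /= !(within_sym e_sym _ _ z).
  by case/orP=> /(near_trans gz).
split=> [g|g g' z|].
- by rewrite !inE => /orP [/eqP ->|/eM].
- rewrite !inE => /orP [/eqP ->|gM] /orP [/eqP ->|g'M] // gz g'z.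
  + by have := dis _ _ g'M g'z gz.
  + by have := dis _ _ gM gz g'z.
  exact: dM g'z.
have csym := sym_connect_sym (hop_sym ((x, y) |: M)).
suff cf g : g \in (x, y) |: M -> connect (hop ((x, y) |: M)) f g.
  by move=> g g' /cf fg /cf fg'; apply: connect_trans fg'; rewrite csym.
case/setU1P=> [->|gM].
  by apply: connect1; rewrite /hop !inE eqxx fM fx orbT.
apply: connect_sub (cM f g fM gM) => a b /and3P [aM bM ab].
by apply: connect1; rewrite /hop !inE aM bM ab !orbT.
Qed.

(** Take a maximal packing containing the given edge. If coverage stops along an edge xy, with [x]
    covered and [y] not, then neither end is within 4 of [M], so (x, y) can be added; maximality
    puts it in [M], where it covers [y]. *)
Lemma packing_cover x0 y0 : e x0 y0 ->
  exists M, [/\ packing M, M != set0 & forall x, exists2 f, f \in M & near 5 f x].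
Proof.
move=> xy0; pose M0 := [set (x0, y0)].
have pM0 : packing M0.
  by apply/packingP; split=> [f|f g x|f g]; rewrite !inE => /eqP -> // /eqP ->.
have [M /maxsetP [pM maxM] M0M] := maxset_exists pM0; exists M.
have f0M : (x0, y0) \in M by rewrite -sub1set.
split=> //; first by apply/set0Pn; exists (x0, y0).
suff step x y : e x y -> (exists2 f, f \in M & near 5 f x) ->
                         (exists2 f, f \in M & near 5 f y).
  move=> x; have /connectP [p xp ->] := e_conn x0 x.
  have: exists2 f, f \in M & near 5 f x0.
    by exists (x0, y0); rewrite // /near within_refl.
  by elim: p (x0) xp => [|z p IH] w //= /andP [wz zp] /(step _ _ wz) /(IH _ zp).
move=> xy [f fM fx]; apply/exists_inP; apply: contraT => /exists_inPn far.
have farx g : g \in M -> ~~ near 4 g x.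
  move=> gM; apply: contra (far g gM) => gx.
  by apply: (near_trans (k := 1) gx); apply: within_edge.
have pM' : packing ((x, y) |: M).
  apply: packing_add fM fx _ => // g gM; split; first exact: farx.
  by apply: contra (far g gM); apply: near_mono.
have := farx (x, y); rewrite -(maxM _ pM' (subsetUr _ _)) setU11 => /(_ isT).
by rewrite /near within_refl.
Qed.

(** Each hop costs at most 1 to cross its edge and 5 to reach the next; the last edge may need one
    more crossing. *)
Lemma hop_within M k f g x y : (forall f, f \in M -> e f.1 f.2) -> f \in M ->
    within (hop M) k f g -> x = f.1 \/ x = f.2 -> y = g.1 \/ y = g.2 ->
  within e (6 * k + 1) x y.
Proof.
move=> eM; elim: k f x => [|k IH] f x fM.
  move/eqP=> <- fx fy; have := eM f fM.
  case: fx fy => -> [] -> ff; rewrite ?within_refl ?within_edge //.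
  by rewrite e_sym.
case/orP=> [fg fx gy|/existsP [f' /andP [/and3P [_ f'M ff'] f'g]] fx gy].
  by apply: within_mono (IH f x fM fg fx gy); lia.
have [b [f'b fb]] : exists b, (b = f'.1 \/ b = f'.2) /\ near 5 f b.
  by case/orP: ff' => fb; [exists f'.1|exists f'.2]; split=> //; [left|right].
have [a fa ab] := nearP _ _ _ fb.
have xa : within e 1 x a.
  case: fx fa => -> [] ->; rewrite ?within_refl ?within_edge ?eM //.
  by rewrite e_sym eM.
have := within_trans (within_trans xa ab) (IH f' b f'M f'g f'b gy).
by apply: within_mono; lia.
Qed.

(** Here d is the length of a longest path of [hop M] and S the sum of min(i, d-i). As max(i, d-i) =
    d - min(i, d-i), each vertex in the fibre of p_i saves 6 min(i, d-i) against 6d + 11. *)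
Lemma sum_ecc_bound D x0 y0 : e x0 y0 ->
    (forall u v, e u v -> D <= #|ball2 e u v|) ->
  exists d S, [/\ D * d.+1 <= #|T|, d ^ 2 <= 4 * S + 1
    & \sum_v ecc e v + 6 * (D * S) <= (6 * d + 11) * #|T|].
Proof.
move=> xy0 DB; have [M [/packingP [eM dM cM] /set0Pn [f0 f0M] cov]] := packing_cover xy0.
have hsym := hop_sym M.
have [P [lP P_gt0 PM]] := longest_path_exists hsym f0.
have {}PM f : f \in P -> f \in M by case/PM=> [->|[g /and3P []]].
pose d := (size P).-1.
pose cell v f := (f \in M) && near 2 f v.
(* The edge whose 2-ball contains [v] has priority, then any edge within 5; the default [f0] is
   never reached. *)
pose a v := odflt (odflt f0 [pick f in M | near 5 f v]) [pick f | cell v f].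
have a_near v : a v \in M /\ near 5 (a v) v.
  rewrite /a; case: (pickP (cell v)) => [f /andP [fM fv]|_] /=.
    by split=> //; apply: near_mono fv.
  case: pickP => [f /andP [] //|none]; have [f fM fv] := cov v.
  by have := none f; rewrite /= fM fv.
have a_cell v f : f \in M -> near 2 f v -> a v = f.
  move=> fM fv; rewrite /a; case: (pickP (cell v)) => [g /andP [gM gv]|/(_ f)] /=.
    exact: dM gv fv.
  by rewrite /cell fM fv.
have uP : uniq P by case: lP.
have fibD f : f \in P -> D <= #|[set v | a v == f]|.
  move=> /PM fM; apply: leq_trans (DB _ _ (eM f fM)) _.
  apply/subset_leq_card/subsetP=> v; rewrite !inE => fv.
  by apply/eqP/a_cell.
pose m f := minn (index f P) (d - index f P).
have Pd : size P = d.+1 by rewrite prednK.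
exists d, (\sum_(i < d.+1) minn i (d - i)); split; last 2 first.
- exact: sum_minn_ge.
- have -> : \sum_(i < d.+1) minn i (d - i) = \sum_(f <- P) m f.
    rewrite (big_nth f0) Pd big_mkord; apply: eq_bigr => i _.
    by rewrite /m index_uniq // Pd.
  apply: leq_trans (leq_add (leqnn _) (leq_mul (leqnn 6) (sum_fibers_ge m uP fibD))) _.
  rewrite [X in _ <= X]mulnC -sum_nat_const big_distrr /= [X in _ + X]big_mkcond -big_split /=.
  apply: leq_sum => v _.
  pose E := if a v \in P then maxn (index (a v) P) (d - index (a v) P) else d.
  suff: ecc e v <= 6 * E + 11.
    rewrite /E /m; case: ifP => avP; last by lia.
    have : index (a v) P < size P by rewrite index_mem.
    by rewrite Pd; move: (index _ _) (ecc _ _) => i c; lia.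
  apply/bigmax_leqP=> w _; apply: gdist_within.
  have [avM /nearP [x ax xv]] := a_near v; have [awM /nearP [y ay yw]] := a_near w.
  have connP u f : f \in P -> connect (hop M) (a u) f.
    by move/PM => fM; have [auM _] := a_near u; apply: cM auM fM.
  have avw := longest_path_ecc hsym f0 lP P_gt0 (connP v) (connP w).
  have xy := hop_within eM avM avw ax ay.
  rewrite within_sym // in xv.
  (* 5 to the edge of [v], 6E + 1 along the hops, 5 to [w]. *)
  apply: within_mono (within_trans (within_trans xv xy) yw); rewrite -/E.
  by rewrite addnAC addnC -addnA; apply: leqnn.
have := sum_fibers_ge (fun=> 1) uP fibD; rewrite sum1_size Pd => /leq_trans; apply.
by rewrite sum1_card max_card.
Qed.

End Packing.

(** * The final estimate *)

Lemma delta_circE d : 3 <= d -> delta_circ d = Posz (dcirc d).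
Proof. by move=> d3; rewrite /delta_circ /dcirc; case: odd; nia. Qed.

Local Open Scope ring_scope.

(** Multiply by K and replace K D S by the smaller N S; dividing by N then leaves a quadratic
    inequality in K and d, which is [quad] up to the factor 2/3. *)
Lemma diameter_arith (F : realFieldType) (N D K d S : F) :
    0 < N -> 0 <= d -> 0 <= S -> d + 1 <= K -> N <= K * D -> d ^+ 2 <= 4 * S + 1 ->
  (6 * d + 11) * N - 6 * (D * S) <= (9 / 2 * K + 8) * N.
Proof.
move=> N0 d0 S0 dK NKD dS; have K0 : 0 < K by lra.
have quad : 4 * d * K + 2 * K - 3 * K ^+ 2 <= 4 * S.
  (* This expression equals d^2 - 1 - (4dK + 2K - 3K^2). *)
  have : 0 <= (K - d - 1) * (3 * (K - d) + 1) + 2 * d * (K - d - 1).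
    by rewrite addr_ge0 // mulr_ge0 //; lra.
  by move: dS; nra.
have NS : N * S <= K * D * S by rewrite ler_wpM2r.
have Nquad := ler_wpM2l (ltW N0) quad.
rewrite -subr_ge0 -(pmulr_rge0 _ K0); lra.
Qed.

Theorem theorem4 (T : finType) (e : rel T) (n delta : nat)
    (e_sym : symmetric e) (e_irr : irreflexive e)
    (e_conn : gconnected e)
    (order_n : #|T| = n)
    (min_deg : min_degree e = delta) (delta_ge3 : (3 <= delta)%N)
    (noC4 : ~ has_cycle e 4) (noC5 : ~ has_cycle e 5) :
  avec e <=
    9 / 2 * (Num.ceil (n%:R / (delta_circ delta)%:~R : rat))%:~R + 8.
Proof.
case: e_conn => T_gt0 conn.
have deg v : (delta <= degree e v)%N by rewrite -min_deg min_degree_le.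
have [x0 _] : exists x0 : T, x0 \in T by apply/card_gt0P.
have [y0 xy0] : exists y0, e x0 y0.
  have /card_gt0P [y0] : (0 < degree e x0)%N by have := deg x0; lia.
  by rewrite inE; exists y0.
have [d [S [DT dS sumE]]] := sum_ecc_bound e_sym conn xy0
  (fun u v => card_ball2 e_sym e_irr noC4 noC5 deg delta_ge3).
rewrite (delta_circE delta_ge3) /avec -order_n -!pmulrn.
have D_gt0 : (0 < dcirc delta)%N by rewrite /dcirc; case: odd; nia.
set D := dcirc delta in DT sumE D_gt0 *.
have N0 : 0 < #|T|%:R :> rat by rewrite ltr0n.
have D0 : 0 < D%:R :> rat by rewrite ltr0n.
set K := (Num.ceil _)%:~R.
have NK : #|T|%:R / D%:R <= K :> rat by apply: Num.Theory.ceil_ge.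
rewrite (ler_pdivrMr _ _ N0) -natr_sum.
apply: le_trans (_ : (6 * d%:R + 11) * #|T|%:R - 6 * (D%:R * S%:R) <= _).
  by rewrite lerBrDr -!(natrM, natrD) ler_nat.
apply: diameter_arith; rewrite ?ler0n //.
(* D(d + 1) <= n gives d + 1 <= n/D <= K. *)
- by apply: le_trans NK; rewrite ler_pdivlMr // natr1 -natrM ler_nat mulnC.
- by rewrite -ler_pdivrMr.
by rewrite -natrX -natrM natr1 ler_nat -[((_ * _).+1)%N]addn1.
Qed.
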